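(* Let $n\ge1$, let $w_0,\dots,w_n$ be positive integers, $\mu=w_0+\cdots+w_n$, and let $F^{sing}(\boldsymbol t)=\sum_{\boldsymbol\alpha\in\mathbb{N}^\mu}A(\boldsymbol\alpha)\frac{t^{\boldsymbol\alpha}}{\boldsymbol\alpha!}$ be the potential, in the flat coordinates $t_0,\dots,t_{\mu-1}$, of the canonical Frobenius structure attached to the Laurent polynomial $f(u_0,\dots,u_n)=u_0+\cdots+u_n$ on $U=\{\prod_iu_i^{w_i}=1\}\subset\mathbb{C}^{n+1}$. Then $F^{sing}$ is determined by the numbers $A_{1jk}(\boldsymbol0)$ with $j,k\in\{0,\dots,\mu-1\}$ such that $\overline{1+j+k}=n$; that is, all its coefficients $A(\boldsymbol\alpha)$ with $\alpha_0+\cdots+\alpha_{\mu-1}\ge3$ are uniquely determined by these numbers through the WDVV equations, the homogeneity condition and the initial conditions recalled in the context.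
   Context: $\overline m$ is reduction modulo $\mu$ in $\{0,\dots,\mu-1\}$. $I(\gamma)=\{i\mid\gamma w_i\in\mathbb{Z}\}$; $s(0)\le\cdots\le s(\mu-1)$ is the nondecreasing enumeration with repetitions of the disjoint union over $i$ of $\{\ell/w_i\mid0\le\ell\le w_i-1\}$; $\sigma(i)=i-\mu s(i)$. $A_{ijk}(\boldsymbol\alpha)$ denotes $A(\boldsymbol\alpha+\epsilon_i+\epsilon_j+\epsilon_k)$, where $\epsilon_i$ are the standard basis vectors of $\mathbb{N}^\mu$; so $A_{ijk}(\boldsymbol 0)=F^{sing}_{ijk}(0)$, with $F^{sing}_{ijk}=\partial^3F^{sing}/\partial t_i\partial t_j\partial t_k$. The Frobenius structure lives on the germ of the base of a universal unfolding of $f$; $t_0,\dots,t_{\mu-1}$ are flat coordinates centered at the base point in which the (constant) flat form is $g(\partial_{t_k},\partial_{t_\ell})=\left(\prod_{i\in I(s(k))}w_i\right)^{-1}$ if $\overline{k+\ell}=n$ and $0$ otherwise, and the Euler field is $\mathfrak{E}=\sum_{k=0}^{\mu-1}(1-\sigma(k))t_k\partial_{t_k}+\mu\partial_{t_1}$. Write $(g^{ab})$ for the inverse matrix of $g$, and $a^\star$ for the unique index with $g^{aa^\star}\ne0$. The potential satisfies, for all $i,j,k,\ell$: (WDVV) $\sum_aF^{sing}_{ija}g^{aa^\star}F^{sing}_{a^\star k\ell}=\sum_aF^{sing}_{jka}g^{aa^\star}F^{sing}_{a^\star i\ell}$; (homogeneity) $\mathfrak{E}\cdot F^{sing}=(3-n)F^{sing}$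 (the potential being considered up to polynomials of degree $\le2$); (initial conditions) $F^{sing}_{ijk}(\boldsymbol0)=g|_{\boldsymbol t=0}(\partial_{t_i}\star\partial_{t_j},\partial_{t_k})$, $\star$ being the product of the Frobenius structure. At $\boldsymbol t=0$, $\partial_{t_i}\star\partial_{t_j}$ is a nonzero multiple of $\partial_{t_{\overline{i+j}}}$; in particular $A_{1jk}(\boldsymbol0)=0$ if $\overline{1+j+k}\neq n$. *)

(* Defs.v *)
From HB Require Import structures.
From mathcomp Require Export all_boot all_order all_algebra.
From mathcomp Require Export reals complex mpoly.

Set Implicit Arguments.
Unset Strict Implicit.
Unset Printing Implicit Defensive.

Import Order.TTheory GRing.Theory Num.Theory.

Local Open Scope ring_scope.

(* Formal power series in t_0, ..., t_(m-1), given by the ordinary coefficient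
   of each monomial t^alpha. *)
Definition fps (K : Type) (m : nat) : Type := 'X_{1..m} -> K.

Section FormalPowerSeries.
Variables (K : comNzRingType) (m : nat).
Implicit Types (F G : fps K m) (i j k : 'I_m) (alpha : 'X_{1..m}).

Definition fps_mul F G : fps K m := fun alpha =>
  \sum_(b : 'X_{1..m < (mdeg alpha).+1, (mdeg alpha).+1}
         | alpha == (b.1 + b.2)%MM) F b.1 * G b.2.

Definition fps_var i : fps K m := fun alpha => (alpha == U_(i)%MM)%:R.

Definition fps_const (c : K) : fps K m := fun alpha =>
  if alpha == 0%MM then c else 0.

Definition fps_deriv i F : fps K m := fun alpha =>
  F (alpha + U_(i))%MM *+ (alpha i).+1.

Definition fps_deriv3 i j k F : fps K m :=
  fps_deriv i (fps_deriv j (fps_deriv k F)).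

(* The number A(alpha) in F = \sum_alpha A(alpha) t^alpha / alpha!. *)
Definition Acoef F alpha : K := F alpha *+ \prod_(i < m) (alpha i)`!.

(* The number A_ijk(alpha) = A(alpha + e_i + e_j + e_k). *)
Definition Acoef3 F i j k alpha : K :=
  Acoef F (alpha + U_(i) + U_(j) + U_(k))%MM.

End FormalPowerSeries.

Section Weights.
Variables (n : nat) (w : 'I_n.+1 -> nat).

Definition mu : nat := (\sum_(i < n.+1) w i)%N.

Lemma mu_gt1 : (1 <= n)%N -> (forall i, (0 < w i)%N) -> (1 < mu)%N.
Proof.
move=> n_gt0 w_gt0; have: (\sum_(i < n.+1) 1 <= mu)%N by apply: leq_sum.
by rewrite sum1_card card_ord; apply: leq_trans.
Qed.

Definition index1 (hn : (1 <= n)%N) (hw : forall i, (0 < w i)%N) : 'I_mu :=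
  Ordinal (mu_gt1 hn hw).

Lemma add_index_subproof (i j : 'I_mu) : ((i + j) %% mu < mu)%N.
Proof. by rewrite ltn_pmod // (leq_ltn_trans _ (ltn_ord i)). Qed.

(* The index i + j reduced modulo mu. *)
Definition add_index (i j : 'I_mu) : 'I_mu := Ordinal (add_index_subproof i j).

Definition spectrum : seq rat :=
  sort <=%R (flatten [seq [seq l%:R / (w i)%:R | l <- iota 0 (w i)]
                     | i <- enum 'I_n.+1]).

Definition s (k : nat) : rat := spectrum`_k.

Definition sigma (k : nat) : rat := k%:R - mu%:R * s k.

Definition I_ (gamma : rat) : {set 'I_n.+1} :=
  [set i | gamma * (w i)%:R \is a Num.int].

End Weights.

Section PotentialConditions.
Variables (R : realType) (n : nat) (w : 'I_n.+1 -> nat).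
Local Notation C := (R[i])%C.
Local Notation mu := (mu w).
Implicit Type F : fps C mu.

Definition gmx : 'M[C]_mu := \matrix_(k < mu, l < mu)
  if ((k + l) %% mu == n)%N then (\prod_(i in I_ w (s w k)) (w i)%:R)^-1
  else 0.

Definition gform (u v : 'rV[C]_mu) : C := (u *m gmx *m v^T) 0 0.

(* The vector d/dt_k in the tangent space at the base point t = 0. *)
Definition dt (k : 'I_mu) : 'rV[C]_mu := delta_mx 0 k.

Definition ginv : 'M[C]_mu := invmx gmx.

(* The index written a^star: the only b such that g^(ab) is nonzero. *)
Definition dual_index (a : 'I_mu) : 'I_mu :=
  odflt a [pick b | ginv a b != 0].

Definition wdvv F : Prop :=
  forall (i j k l : 'I_mu) (alpha : 'X_{1..mu}),
    \sum_(a < mu) ginv a (dual_index a) *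
      fps_mul (fps_deriv3 i j a F) (fps_deriv3 (dual_index a) k l F) alpha =
    \sum_(a < mu) ginv a (dual_index a) *
      fps_mul (fps_deriv3 j k a F) (fps_deriv3 (dual_index a) i l F) alpha.

(* The k-th component (1 - sigma(k)) t_k + delta_(k,1) mu of the Euler field. *)
Definition euler_comp (k : 'I_mu) : fps C mu := fun alpha =>
  ratr (1 - sigma w k) * fps_var C k alpha
  + @fps_const C mu (if (k == 1 :> nat)%N then mu%:R else 0) alpha.

Definition euler F : fps C mu := fun alpha =>
  \sum_(k < mu) fps_mul (euler_comp k) (fps_deriv k F) alpha.

(* Potentials are taken up to polynomials of degree <= 2, so only the
   coefficients of total degree >= 3 are compared. *)
Definition homogeneity F : Prop :=
  forall alpha : 'X_{1..mu}, (3 <= mdeg alpha)%N ->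
    euler F alpha = (3%:R - n%:R) * F alpha.

(* A product on the tangent space at t = 0 is given by its values
   [star i j] = d/dt_i * d/dt_j on the basis; each of these is a nonzero
   multiple of d/dt_k for k = i + j modulo mu.  For the product of a Frobenius
   structure, commutativity, associativity and compatibility with g follow
   from [initial_value] and [wdvv]. *)
Definition graded_product (star : 'I_mu -> 'I_mu -> 'rV[C]_mu) : Prop :=
  forall i j : 'I_mu, exists2 c : C, c != 0 & star i j = c *: dt (add_index i j).

Definition initial_value (star : 'I_mu -> 'I_mu -> 'rV[C]_mu) F : Prop :=
  forall i j k : 'I_mu, fps_deriv3 i j k F 0%MM = gform (star i j) (dt k).

(* The conditions satisfied by the potential of the canonical Frobenius
   structure of f = u_0 + ... + u_n on prod_i u_i^(w_i) = 1, with [star] its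
   product at the base point. *)
Definition is_potential (star : 'I_mu -> 'I_mu -> 'rV[C]_mu) F : Prop :=
  [/\ wdvv F, homogeneity F, graded_product star & initial_value star F].

End PotentialConditions.

(* Main.v *)
(** Induction on the order of [gamma] shows that all F_{ijk}(gamma) are
    determined.  The Euler field contains [mu] d/dt_1, so homogeneity expresses
    F_{1jk}(gamma) through coefficients of lower order once [gamma] is nonzero;
    for [gamma = 0] these numbers are given, or vanish.  At the base point d/dt_1
    generates the tangent algebra, its powers running through multiples of all
    the d/dt_i.  Hence WDVV propagates the knowledge of F_{ijk}(gamma) from the
    index [i] to [i + 1], starting at [i = 1] and ending at [i = mu = 0]. *)

Require Import Defs.

Set Implicit Arguments.
Unset Strict Implicit.
Unset Printing Implicit Defensive.

Import Order.TTheory GRing.Theory Num.Theory.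

Local Open Scope ring_scope.

(** * Coefficients of products of power series *)

Section FormalPowerSeries.
Variables (K : comNzRingType) (m : nat).
Implicit Types (F G : fps K m) (alpha beta delta : 'X_{1..m}).

(** Serves the Euler field: each component is a constant plus a multiple of one variable, so one
    term of each convolution survives. *)
Lemma fps_mul_single F G delta beta :
    (forall b, b != delta -> F b = 0) ->
  fps_mul F G (delta + beta)%MM = F delta * G beta.
Proof.
move=> F0; rewrite /fps_mul; set d := (mdeg _).+1.
have ltd : (mdeg delta < d)%N by rewrite ltnS mdegD leq_addr.
have ltb : (mdeg beta < d)%N by rewrite ltnS mdegD leq_addl.
rewrite (bigD1 (BMultinom ltd, BMultinom ltb)) //= big1 ?addr0 //.
case=> b1 b2 /= /andP[/eqP eqb neqb]; rewrite F0 ?mul0r //.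
apply: contraNneq neqb => eqb1; apply/eqP; congr pair; apply: val_inj => //=.
by move: eqb; rewrite eqb1 => /addmI.
Qed.

Lemma fps_mul_const c G alpha : fps_mul (fps_const c) G alpha = c * G alpha.
Proof.
rewrite -{1}[alpha]add0m fps_mul_single /fps_const ?eqxx //.
by move=> b /negPf ->.
Qed.

Lemma fps_mul_var_deriv i F alpha :
  fps_mul (fps_var K i) (fps_deriv i F) alpha = F alpha *+ alpha i.
Proof.
have [ai0|ai_gt0] := posnP (alpha i).
  rewrite ai0 mulr0n /fps_mul big1 // => -[b1 b2] /= /eqP eqb.
  rewrite /fps_var; case: eqP => [b1E|]; last by rewrite mul0r.
  by move: (congr1 (fun a : 'X_{1..m} => a i) eqb); rewrite b1E mnmDE mnm1E eqxx ai0.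
have le1a : (U_(i) <= alpha)%MM.
  by apply/mnm_lepP => k; rewrite mnm1E; case: eqP => // <-.
rewrite -{1}(submK le1a) addmC fps_mul_single /fps_var ?eqxx; last first.
  by move=> b /negPf ->.
by rewrite mul1r /fps_deriv submK // mnmBE mnm1E eqxx subn1 prednK.
Qed.

Lemma fps_mulDl F F' G alpha :
  fps_mul (fun b => F b + F' b) G alpha = fps_mul F G alpha + fps_mul F' G alpha.
Proof. by rewrite /fps_mul -big_split; apply: eq_bigr => b _; rewrite mulrDl. Qed.

Lemma fps_mulZl c F G alpha :
  fps_mul (fun b => c * F b) G alpha = c * fps_mul F G alpha.
Proof. by rewrite /fps_mul mulr_sumr; apply: eq_bigr => b _; rewrite mulrA. Qed.

Lemma fps_mul_eq F F' G G' alpha :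
    (forall b, (mdeg b <= mdeg alpha)%N -> F b = F' b) ->
    (forall b, (mdeg b <= mdeg alpha)%N -> G b = G' b) ->
  fps_mul F G alpha = fps_mul F' G' alpha.
Proof.
move=> eqF eqG; apply: eq_bigr => -[b1 b2] /= _.
by rewrite eqF ?eqG // -ltnS bmdeg.
Qed.

(** The only term with a coefficient of [G] of order [mdeg alpha] pairs it with the constant term of
    [F]; the others cancel. *)
Lemma fps_mul_sub_top F F' G G' alpha :
    (forall b, (mdeg b <= mdeg alpha)%N -> F b = F' b) ->
    (forall b, (mdeg b < mdeg alpha)%N -> G b = G' b) ->
  fps_mul F G alpha - fps_mul F' G' alpha = F 0%MM * (G alpha - G' alpha).
Proof.
move=> eqF eqG; rewrite /fps_mul -sumrB.
have lt0 : (mdeg (0%MM : 'X_{1..m}) < (mdeg alpha).+1)%N by rewrite mdeg0.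
rewrite (bigD1 (BMultinom lt0, BMultinom (ltnSn (mdeg alpha)))) /= ?add0m //.
rewrite -eqF ?mdeg0 // -mulrBr big1 ?addr0 //.
case=> b1 b2 /= /andP[/eqP eqb neqb].
have le1 : (mdeg b1 <= mdeg alpha)%N by rewrite -ltnS bmdeg.
rewrite eqF // eqG ?subrr //; rewrite [ltnRHS](congr1 mdeg eqb).
rewrite mdegD -[ltnLHS]add0n ltn_add2r lt0n mdeg_eq0.
apply: contraNneq neqb => b10; apply/eqP; congr pair; apply: val_inj => //=.
by move: eqb; rewrite b10 add0m.
Qed.

End FormalPowerSeries.

(** * Cancelling the integer factors of derivatives and factorials *)

Section CharacteristicZero.
Variables (K : numDomainType) (m : nat).
Implicit Types (F : fps K m) (alpha : 'X_{1..m}).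

Lemma fps_deriv3_eq F F' i j k alpha :
  fps_deriv3 i j k F alpha = fps_deriv3 i j k F' alpha <->
  F (alpha + U_(i) + U_(j) + U_(k))%MM = F' (alpha + U_(i) + U_(j) + U_(k))%MM.
Proof.
rewrite /fps_deriv3 /fps_deriv; split=> [|-> //].
by do 3!move/(pmulrnI (ltn0Sn _)).
Qed.

Lemma Acoef_eq F F' alpha :
  Acoef F alpha = Acoef F' alpha <-> F alpha = F' alpha.
Proof.
rewrite /Acoef; split=> [/pmulrnI|-> //]; apply.
by apply: prodn_gt0 => i; apply: fact_gt0.
Qed.

End CharacteristicZero.

Lemma mdeg_gt0_split (m : nat) (alpha : 'X_{1..m}) :
  (0 < mdeg alpha)%N -> exists i beta, alpha = (beta + U_(i))%MM.
Proof.
rewrite lt0n mdeg_eq0 => nz.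
have [i ai|a0] := pickP [pred i | alpha i != 0%N].
  exists i, (alpha - U_(i))%MM; rewrite submK //.
  apply/mnm_lepP => k; rewrite mnm1E; case: eqP => //= <-.
  by rewrite lt0n.
case/eqP: nz; apply/mnmP => i; rewrite mnm0E.
by have /= /negbFE/eqP := a0 i.
Qed.

(** * The flat form and its inverse *)

Section Pairing.
Variables (R : realType) (n : nat) (w : 'I_n.+1 -> nat).
Hypothesis w_gt0 : forall i, (0 < w i)%N.
Local Notation C := (complex R).
Local Notation mu := (mu w).

Lemma ltn_mu : (n < mu)%N.
Proof.
have: (\sum_(i < n.+1) 1 <= mu)%N by apply: leq_sum.
by rewrite sum1_card card_ord.
Qed.

(** This is n - a modulo mu; writing mu - a avoids truncated subtraction. *)
Definition gdual (a : 'I_mu) : 'I_mu :=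
  Ordinal (ltn_pmod (n + (mu - a)) (leq_ltn_trans (leq0n n) ltn_mu)).

Lemma gdualP (a b : 'I_mu) : ((a + b) %% mu == n)%N = (b == gdual a).
Proof.
rewrite -[X in _ == X](modn_small ltn_mu).
rewrite -(eqn_modDr (mu - a)) addnAC subnKC ?(ltnW (ltn_ord a)) //.
by rewrite modnDl (modn_small (ltn_ord b)).
Qed.

Lemma gdualK : involutive gdual.
Proof. by move=> a; apply/esym/eqP; rewrite -gdualP addnC gdualP. Qed.

Definition gweight (k : 'I_mu) : C := \prod_(i in I_ w (s w k)) (w i)%:R.

Lemma gweight_neq0 k : gweight k != 0.
Proof. by apply/prodf_neq0 => i _; rewrite pnatr_eq0 -lt0n. Qed.

Lemma gmxE a b : gmx R w a b = if b == gdual a then (gweight a)^-1 else 0.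
Proof. by rewrite mxE gdualP. Qed.

Lemma ginvE a b : ginv R w a b = if b == gdual a then gweight b else 0.
Proof.
pose h : 'M[C]_mu := \matrix_(a, b) if b == gdual a then gweight b else 0.
(* For square matrices a left inverse is the inverse. *)
suff hg : h *m gmx R w = 1%:M.
  have [_ gU] := mulmx1_unit hg.
  by rewrite /ginv -[invmx _]mul1mx -hg -mulmxA mulmxV // mulmx1 mxE.
apply/matrixP => i j; rewrite mxE (bigD1 (gdual i)) //= big1 => [|k /negPf ki].
  rewrite mxE eqxx gmxE gdualK addr0 mxE eq_sym.
  by case: eqP => _; rewrite ?mulr0 ?mulfV ?gweight_neq0.
by rewrite mxE ki mul0r.
Qed.

(** Row [a] of [ginv] has its only nonzero entry at [gdual a], so the default of [odflt] never
    occurs. *)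
Lemma dual_indexE a : dual_index R a = gdual a.
Proof.
rewrite /dual_index; case: pickP => [b|/(_ (gdual a))] /=; rewrite ginvE.
  by case: (b =P gdual a) => //; rewrite eqxx.
by rewrite eqxx gweight_neq0.
Qed.

Lemma ginv_dual_neq0 a : ginv R w a (dual_index R a) != 0.
Proof. by rewrite dual_indexE ginvE eqxx gweight_neq0. Qed.

Lemma gform_dt i j : gform (dt R i) (dt R j) = gmx R w i j.
Proof. by rewrite /gform /dt trmx_delta -rowE -colE !mxE. Qed.

(** A nonzero multiple of a basis vector pairs nontrivially under g with exactly one basis vector,
    its dual. *)
Lemma initial_value_neq0 star (F : fps C mu) i j k :
    graded_product star -> initial_value star F ->
  (fps_deriv3 i j k F 0%MM != 0) = (k == gdual (add_index i j)).
Proof.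
move=> gr iv; rewrite iv; have [c c0 ->] := gr i j.
rewrite /gform -!scalemxAl mxE -/(gform _ _) gform_dt gmxE mulf_eq0 (negPf c0).
by case: ifP => _ /=; rewrite ?eqxx // invr_eq0 gweight_neq0.
Qed.

End Pairing.

(** * Recursion by homogeneity and WDVV *)

Section Reconstruction.
Variables (R : realType) (n : nat) (w : 'I_n.+1 -> nat).
Hypotheses (hn : (1 <= n)%N) (hw : forall i, (0 < w i)%N).
Local Notation C := (complex R).
Local Notation mu := (mu w).
Local Notation e1 := (index1 hn hw).

Lemma eulerE (F : fps C mu) alpha :
  euler F alpha =
    (\sum_(k < mu) ratr (1 - sigma w k) * (F alpha *+ alpha k))
    + mu%:R * fps_deriv e1 F alpha.
Proof.
rewrite /euler.
under eq_bigr => k _ do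
  rewrite /euler_comp fps_mulDl fps_mulZl fps_mul_var_deriv fps_mul_const.
rewrite big_split /=; congr (_ + _).
rewrite (bigD1 e1) //= big1 ?addr0 // => k /negPf k1.
by rewrite -[(k == 1 :> nat)%N]/(k == e1) k1 mul0r.
Qed.

(** At [alpha], every term of the homogeneity equation except that of mu d/dt_1 is a multiple of
    [F alpha]; since mu is nonzero, the equation can be solved for the remaining coefficient. *)
Lemma homogeneity_eq (F F' : fps C mu) alpha :
    homogeneity F -> homogeneity F' -> (3 <= mdeg alpha)%N ->
    F alpha = F' alpha ->
  F (alpha + U_(e1))%MM = F' (alpha + U_(e1))%MM.
Proof.
move=> hF hF' le3 eqF.
have := hF _ le3; rewrite eqF -(hF' _ le3) !eulerE eqF => /addrI /mulfI.
have mu0 : mu%:R != 0 :> C by rewrite pnatr_eq0 -lt0n (ltnW (mu_gt1 hn hw)).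
by move=> /(_ mu0) /(pmulrnI (ltn0Sn _)).
Qed.

Variables (star star' : 'I_mu -> 'I_mu -> 'rV[C]_mu) (F F' : fps C mu).
Hypotheses (hF : is_potential star F) (hF' : is_potential star' F').

Definition agree_at i j k gamma : Prop :=
  fps_deriv3 i j k F gamma = fps_deriv3 i j k F' gamma.

Lemma agree_atCA i j k gamma : agree_at i j k gamma -> agree_at j i k gamma.
Proof.
move=> /fps_deriv3_eq eqF; apply/fps_deriv3_eq.
by rewrite -(addmA gamma) (addmC U_(j)%MM) addmA.
Qed.

(* In the WDVV equation with indices (1, i, j, l) at [gamma], the only product
   that is not yet known involves F_{1+i, j, l}(gamma), with the nonzero
   coefficient F_{1, i, a}(0), where a is the index dual to 1 + i. *)
Lemma agree_at_add_index1 gamma i :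
    (forall beta i j k, (mdeg beta < mdeg gamma)%N -> agree_at i j k beta) ->
    (forall beta j k, (mdeg beta <= mdeg gamma)%N -> agree_at e1 j k beta) ->
    (forall beta j k, (mdeg beta <= mdeg gamma)%N -> agree_at i j k beta) ->
  forall j l, agree_at (add_index e1 i) j l gamma.
Proof.
case: hF => W _ gr iv; case: hF' => W' _ _ _ IH eq1 eqi j l.
have := W e1 i j l gamma.
have -> : \sum_(a < mu) ginv R w a (dual_index R a) *
    fps_mul (fps_deriv3 i j a F) (fps_deriv3 (dual_index R a) e1 l F) gamma =
  \sum_(a < mu) ginv R w a (dual_index R a) *
    fps_mul (fps_deriv3 i j a F') (fps_deriv3 (dual_index R a) e1 l F') gamma.
  apply: eq_bigr => a _; congr (_ * _); apply: fps_mul_eq => b leb.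
    exact: eqi.
  by apply: agree_atCA; apply: eq1.
rewrite -(W' e1 i j l gamma) => /eqP; rewrite -subr_eq0 -sumrB.
pose a := gdual hw (add_index e1 i).
rewrite (bigD1 a) //= big1 => [|b ba].
  rewrite addr0 -mulrBr fps_mul_sub_top; [|by move=> b lt; apply: eq1|by move=> b lt; apply: IH].
  rewrite !mulf_eq0 (negPf (ginv_dual_neq0 _ hw _)) /=.
  rewrite (negPf (_ : fps_deriv3 e1 i a F 0%MM != 0)); last first.
    by rewrite (initial_value_neq0 hw _ _ _ gr iv).
  by rewrite (dual_indexE _ hw) gdualK subr_eq0 => /eqP.
rewrite -mulrBr fps_mul_sub_top; [|by move=> c lt; apply: eq1|by move=> c lt; apply: IH].
have := initial_value_neq0 hw e1 i b gr iv.
by rewrite (negPf ba) => /negbFE/eqP ->; rewrite mul0r mulr0.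
Qed.

Hypothesis agree_Acoef : forall j k : 'I_mu, ((1 + j + k) %% mu)%N = n ->
  Acoef3 F e1 j k 0%MM = Acoef3 F' e1 j k 0%MM.

Lemma agree_at_index1 gamma j k :
    (forall beta i j k, (mdeg beta < mdeg gamma)%N -> agree_at i j k beta) ->
  agree_at e1 j k gamma.
Proof.
case: hF => _ H gr iv; case: hF' => _ H' gr' iv' IH.
have [|/mdeg_gt0_split[i [beta eg]]] := posnP (mdeg gamma).
  move/eqP; rewrite mdeg_eq0 => /eqP ->.
  have [kj|kj] := eqVneq k (gdual hw (add_index e1 j)).
    apply/fps_deriv3_eq/Acoef_eq/agree_Acoef.
    apply/eqP; rewrite -modnDml -[((1 + j) %% mu)%N]/(add_index e1 j : nat).
    by rewrite gdualP kj.
  have := initial_value_neq0 hw e1 j k gr iv.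
  have := initial_value_neq0 hw e1 j k gr' iv'.
  by rewrite (negPf kj) /agree_at => /negbFE/eqP -> /negbFE/eqP ->.
(* Moving e_1 last exposes homogeneity at gamma + e_j + e_k, of degree at least 3 because gamma is
   nonzero. *)
apply/fps_deriv3_eq; rewrite -2!addmA (addmC U_(e1)%MM) addmA.
apply: homogeneity_eq => //; first by rewrite eg !mdegD !mdeg1 -addnA leq_addl.
(* With gamma = beta + e_i, the coefficient at gamma + e_j + e_k belongs to F_{ijk}(beta), of lower
   order. *)
rewrite eg addmA; apply/fps_deriv3_eq/IH.
by rewrite eg mdegD mdeg1 addn1.
Qed.

Lemma agree_at_all gamma i j k : agree_at i j k gamma.
Proof.
have [d] := ubnP (mdeg gamma); elim: d gamma i j k => // d IHd gamma i j k.
rewrite ltnS => led.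
have IH beta i' j' k' : (mdeg beta < d)%N -> agree_at i' j' k' beta by apply: IHd.
have eq1 beta j' k' : (mdeg beta <= d)%N -> agree_at e1 j' k' beta.
  move=> leb; apply: agree_at_index1 => c i1 j1 k1 ltc.
  exact/IH/(leq_trans ltc).
(* All orders up to [d] are carried along, since the WDVV convolutions involve them too. *)
suff all_m m : forall (i : 'I_mu) beta j k,
    i = (m.+1 %% mu)%N :> nat -> (mdeg beta <= d)%N -> agree_at i j k beta.
  (* Here m + 1 = i + mu, which is i modulo mu; this also reaches i = 0. *)
  apply: (all_m (i + mu.-1)%N) => //.
  rewrite -addnS prednK ?(ltnW (mu_gt1 hn hw)) //.
  by rewrite modnDr modn_small.
elim: m => [|m IHm] {}i beta {}j {}k iE leb.
  have -> : i = e1 by apply: val_inj; rewrite /= iE modn_small // mu_gt1.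
  exact: eq1.
have mu_gt0 := ltnW (mu_gt1 hn hw).
have -> : i = add_index e1 (Ordinal (ltn_pmod m.+1 mu_gt0)).
  by apply: val_inj; rewrite /= modnDmr iE.
apply: agree_at_add_index1 => [c i1 j1 k1 ltc|c j1 k1 lec|c j1 k1 lec].
- exact/IH/(leq_trans ltc).
- exact/eq1/(leq_trans lec).
- exact/IHm/(leq_trans lec).
Qed.

End Reconstruction.

Theorem mainTheorem6 (R : realType) (n : nat) (hn : (1 <= n)%N)
    (w : 'I_n.+1 -> nat) (hw : forall i : 'I_n.+1, (0 < w i)%N)
    (star star' : 'I_(mu w) -> 'I_(mu w) -> 'rV[complex R]_(mu w))
    (F F' : fps (complex R) (mu w))
    (hF : is_potential star F) (hF' : is_potential star' F')
    (hA : forall j k : 'I_(mu w), ((1 + j + k) %% mu w)%N = n ->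
       Acoef3 F (index1 hn hw) j k 0%MM = Acoef3 F' (index1 hn hw) j k 0%MM) :
  forall alpha : 'X_{1..mu w}, (3 <= mdeg alpha)%N ->
    Acoef F alpha = Acoef F' alpha.
Proof.
move=> alpha le3; apply/Acoef_eq; move: le3.
(* Splitting off three unit vectors turns a coefficient of degree at least 3 into one of a third
   derivative. *)
case: (posnP (mdeg alpha)) => [-> //|/mdeg_gt0_split[k [b ->]]].
rewrite mdegD mdeg1 addn1 ltnS => le2.
have /mdeg_gt0_split[j [c eb]] := ltnW le2.
move: le2; rewrite eb mdegD mdeg1 addn1 ltnS => /mdeg_gt0_split[i [d ->]].
exact/fps_deriv3_eq/(agree_at_all hF hF' hA).
Qed.
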